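(* Let $G$ and $G'$ be graphs. Suppose that (a1) $\Delta G\ge 1$ and $G\in\mathcal{CG}_{\bowtie}$, (a2) $\Delta(G\setminus x)\ge 1$ and $G\setminus x\in\mathcal{CG}_{\bowtie}$ for every vertex $x$ in $G$, and (a3) $M_1(G')=M_1(G)$. Then $\mathcal{S}(G)=\mathcal{S}(G')$, i.e. $G$ and $G'$ are strongly isomorphic.
   Context: Graphs are finite and may have loops and parallel edges. For $X\subseteq E(G)$, $G\langle X\rangle$ is the subgraph of $G$ induced by $X$, i.e. with edge set $X$ and whose vertices are the end-vertices of edges in $X$. $\Delta G=|E(G)|-|V(G)|$. $\mathcal{G}_{\bowtie}$ is the set of graphs having no isolated vertices, no leaves (vertices of degree 1, a loop contributing 2 to the degree), and no cycle components (components that are cycles; a vertex with a single loop is a cycle, and two parallel edges form a cycle). $\mathcal{CG}_{\bowtie}$ is the set of connected graphs in $\mathcal{G}_{\bowtie}$. $M_1(G)$ is the ($1$-circular, i.e. bicircular) matroid on $E(G)$ whose circuits are the sets $C\subseteq E(G)$ with $\Delta G\langle C\rangle=1$ and $G\langle C\rangle\in\mathcal{G}_{\bowtie}$ (these are known to be the circuits of a matroid). Equality $M_1(G)=M_1(G')$ means equality of ground sets $E(G)=E(G')$ and of the families of circuits. $G\setminus x$ is $G$ with vertex $x$ and all edges incident to it deleted. $S(x,G)$ is the set of edges of $G$ incident to $x$ (loops included), and $\mathcal{S}(G)=\{S(x,G):x\in V(G)\}$. Graphs $G=(V,E,\phi)$ and $G'=(V',E,\phi')$ with the same edge set are strongly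 isomorphic if there is a bijection $\nu:V\to V'$ such that for each edge $e$: $\phi(e)=\{x,y\}\Leftrightarrow\phi'(e)=\{\nu(x),\nu(y)\}$, where $\phi(e)$ is the set of end-vertices of $e$.
   Formalization: The graph G' is additionally assumed to have no isolated vertices; without this the claim fails, e.g. for G = K_5 and G' = K_5 plus an isolated vertex, which have the same bicircular matroid. *)

(* Defs.v *)
From mathcomp Require Import all_boot all_order all_algebra.

Set Implicit Arguments.
Unset Strict Implicit.
Unset Printing Implicit Defensive.

(* Finite graphs with loops and parallel edges, carried by subsets of ambient
   finite types, so that subgraphs are again graphs over the same types and two
   graphs can have literally the same edge set. A loop has a singleton as its
   set of ends. The value of [ends] outside [eset] is irrelevant. *)
Record mgraph (V E : finType) := MGraph {
  vset : {set V};
  eset : {set E};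
  ends : E -> {set V};
  endsP : forall e, e \in eset -> (ends e \subset vset) && (0 < #|ends e| <= 2)
}.

Section Graphs.

Variables V E : finType.
Implicit Types (G : mgraph V E) (x y : V) (X C : {set E}).

Definition star G x : {set E} := [set e in eset G | x \in ends G e].

Definition stars G : {set {set E}} := [set star G x | x in vset G].

Definition degree G x : nat :=
  #|star G x| + #|[set e in eset G | ends G e == [set x]]|.

Definition Delta G : int := (#|eset G|%:Z - #|vset G|%:Z)%R.

Definition adjacent G : rel V :=
  fun x y => [exists e in eset G, ends G e == [set x; y]].

Definition connected G : bool :=
  (vset G != set0) &&
  [forall x in vset G, forall y in vset G, connect (adjacent G) x y].

Lemma edge_induced_subproof G X e : e \in X :&: eset G ->
  (ends G e \subset \bigcup_(f in X :&: eset G) ends G f)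
  && (0 < #|ends G e| <= 2).
Proof.
move=> eX; have /andP[_ ->] : (ends G e \subset vset G) && (0 < #|ends G e| <= 2).
  by apply: endsP; case/setIP: eX.
by rewrite andbT (bigcup_sup e).
Qed.

Definition edge_induced G X : mgraph V E := MGraph (@edge_induced_subproof G X).

Lemma del_vertex_subproof G x e : e \in [set f in eset G | x \notin ends G f] ->
  (ends G e \subset vset G :\ x) && (0 < #|ends G e| <= 2).
Proof.
by rewrite inE => /andP[/(@endsP _ _ G)/andP[sub ->] xe]; rewrite subsetD1 sub xe.
Qed.

Definition del_vertex G x : mgraph V E := MGraph (@del_vertex_subproof G x).

Definition component_vset G x : {set V} :=
  [set y in vset G | connect (adjacent G) x y].

Lemma component_subproof G x e :
  e \in [set f in eset G | ends G f \subset component_vset G x] ->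
  (ends G e \subset component_vset G x) && (0 < #|ends G e| <= 2).
Proof. by rewrite inE => /andP[/(@endsP _ _ G)/andP[_ ->] ->]. Qed.

Definition component G x : mgraph V E := MGraph (@component_subproof G x).

Definition is_cycle G : bool :=
  connected G && [forall x in vset G, degree G x == 2].

Definition no_isolated G : bool := [forall x in vset G, degree G x != 0].

Definition no_leaves G : bool := [forall x in vset G, degree G x != 1].

Definition no_cycle_components G : bool :=
  [forall x in vset G, ~~ is_cycle (component G x)].

Definition bowtie G : bool :=
  [&& no_isolated G, no_leaves G & no_cycle_components G].

Definition connected_bowtie G : bool := connected G && bowtie G.

Definition bicircular_circuits G : {set {set E}} :=
  [set C : {set E} | [&& C \subset eset G, Delta (edge_induced G C) == 1%R
                       & bowtie (edge_induced G C)]].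

(* The bicircular matroid of G, presented by its ground set and its circuits;
   equality of matroids is equality of these pairs. *)
Definition M1 G : {set E} * {set {set E}} := (eset G, bicircular_circuits G).

End Graphs.

Definition strongly_isomorphic (V V' E : finType)
    (G : mgraph V E) (G' : mgraph V' E) : Prop :=
  eset G = eset G' /\
  exists nu : {x : V | x \in vset G} -> {x : V' | x \in vset G'},
    bijective nu /\
    forall e, e \in eset G -> forall x y : {x : V | x \in vset G},
      ends G e = [set val x; val y] <->
      ends G' e = [set val (nu x); val (nu y)].

(* Main.v *)
(** In the bicircular matroid a set is dependent iff it contains some [Y] with
    more edges than end-vertices, so the nullity of [X] is the maximum over
    [Y] contained in [X] of [|Y| - |V(Y)|].  If [X] spans a connected graph
    without leaves and with [|X| > |V(X)|], counting degrees shows that this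
    maximum is attained at [X] alone; as nullities only depend on the matroid,
    the maximum is then attained at [X] alone in [G'] too, and [X] covers as
    many vertices in [G'] as in [G].  Applied to [E] and to the complement [H]
    of a star [S(x)], this shows that [H] misses exactly one vertex [y] of [G'].
    Adding an edge of [S(x)] to [H] does not increase the nullity, so that edge
    must contain [y]; hence [S(x) = S(y)].  Finally, [x |-> y] is a bijection by
    cardinality. *)

Require Import Defs.
From mathcomp Require Import all_boot all_order all_algebra.
From mathcomp Require Import zify.

Set Implicit Arguments.
Unset Strict Implicit.
Unset Printing Implicit Defensive.

(** * Covered vertices, degree sums and minimal sets with excess *)

Section EndVertices.

Variables V E : finType.
Implicit Types (G : mgraph V E) (X Y I C D : {set E}).

Definition cov G X : {set V} := \bigcup_(e in X) ends G e.

Lemma covP G X v : reflect (exists2 e, e \in X & v \in ends G e) (v \in cov G X).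
Proof. exact: bigcupP. Qed.

Lemma covS G X Y : X \subset Y -> cov G X \subset cov G Y.
Proof.
by move=> /subsetP sXY; apply/subsetP => v /covP[e eX ve]; apply/covP; exists e; auto.
Qed.

Lemma cov0 G : cov G set0 = set0.
Proof. exact: big_set0. Qed.

Lemma covU G X Y : cov G (X :|: Y) = cov G X :|: cov G Y.
Proof. exact: bigcup_setU. Qed.

Lemma cov_sub_vset G X : X \subset eset G -> cov G X \subset vset G.
Proof. by move=> /subsetP sX; apply/bigcupsP => e /sX /endsP /andP[]. Qed.

Lemma cov_eset G : no_isolated G -> cov G (eset G) = vset G.
Proof.
move=> /forall_inP iso; apply/eqP; rewrite eqEsubset cov_sub_vset //=.
apply/subsetP => v vG; have := iso v vG; rewrite /degree addn_eq0 negb_and.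
case/orP; rewrite cards_eq0 => /set0Pn[e]; rewrite inE => /andP[eG ve].
  by apply/covP; exists e.
by apply/covP; exists e => //; rewrite (eqP ve) set11.
Qed.

Lemma sum_degree G : \sum_(v in vset G) degree G v = 2 * #|eset G|.
Proof.
rewrite big_split /=.
have -> : \sum_(v in vset G) #|star G v| = \sum_(e in eset G) #|ends G e|.
  under eq_bigr => v _ do rewrite -sum1_card.
  rewrite (exchange_big_dep (mem (eset G))) /=; last first.
    by move=> v e _; rewrite inE => /andP[].
  apply: eq_bigr => e eG; rewrite -sum1_card; apply: eq_bigl => v.
  rewrite inE eG /=; apply: andb_idl; apply/subsetP.
  by case/andP: (endsP eG).
(* The truncated difference [2 - #|ends G e|] is 1 for a loop and 0 otherwise, so that each edge
   contributes 2 in total. *)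
have -> : \sum_(v in vset G) #|[set e in eset G | ends G e == [set v]]|
    = \sum_(e in eset G) (2 - #|ends G e|).
  under eq_bigr => v _ do rewrite -sum1_card.
  rewrite (exchange_big_dep (mem (eset G))) /=; last first.
    by move=> v e _; rewrite inE => /andP[].
  apply: eq_bigr => e eG; have /andP[/subsetP sub /andP[e0 e2]] := endsP eG.
  have [/cards1P[v ev]|n1] := boolP (#|ends G e| == 1).
    rewrite ev cards1 (big_pred1 v) // => w; rewrite inE eG ev /= (inj_eq set1_inj).
    rewrite eq_sym; apply: andb_idl => /eqP->; apply: sub.
    by rewrite ev set11.
  rewrite big_pred0; first by lia.
  move=> w; rewrite inE eG /=; apply/negbTE; rewrite negb_and orbC.
  by apply/orP; left; apply: contra n1 => /eqP->; rewrite cards1.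
rewrite -big_split /= (eq_bigr (fun=> 2)) => [|e /endsP]; first by rewrite sum_nat_const mulnC.
by case/and3P; lia.
Qed.

Lemma degree_edge_inducedS G X v : degree (edge_induced G X) v <= degree G v.
Proof.
by apply: leq_add; apply: subset_leq_card; apply/subsetP => e; rewrite !inE;
   case/andP => /andP[_ ->].
Qed.

Lemma adjacent_ends G e u v :
  e \in eset G -> u \in ends G e -> v \in ends G e -> u != v -> adjacent G u v.
Proof.
move=> eG ue ve uv; apply/existsP; exists e; rewrite eG /= eq_sym eqEcard.
have /and3P[_ _ e2] := endsP eG; rewrite cards2 uv e2 andbT.
by rewrite subUset !sub1set ue ve.
Qed.

(* Twice [|Y| - |V(Y)|] is the sum of [deg - 2] over the vertices of [Y]. *)
Lemma excess_proper G Y : (1 <= Delta G)%R -> connected_bowtie G ->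
  Y \proper eset G ->
  #|Y| + #|cov G (eset G)| < #|eset G| + #|cov G Y|.
Proof.
rewrite /Delta => D1 /andP[/andP[_ /forall_inP conn] /and3P[iso leaf _]].
rewrite properE => /andP[sY nYs]; rewrite ltnNge; apply/negP => le.
rewrite cov_eset // in le.
have [Y0|/set0Pn[e0 e0Y]] := eqVneq Y set0.
  by move: le; rewrite Y0 cov0 !cards0; lia.
have sW := cov_sub_vset sY.
pose GY := edge_induced G Y.
have eGY : eset GY = Y by apply/setIidPl.
have vGY : vset GY = cov G Y by rewrite /= (setIidPl sY).
have sumY := sum_degree GY; rewrite eGY vGY in sumY.
have deg2 v : v \in vset G -> 2 <= degree G v.
  by move=> vG; move: (forall_inP iso v vG) (forall_inP leaf v vG); case: degree => [|[]].
have sumG := sum_degree G; rewrite (big_setID (cov G Y)) /= (setIidPr sW) in sumG.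
have rest : 2 * (#|vset G| - #|cov G Y|) <= \sum_(v in vset G :\: cov G Y) degree G v.
  have -> : #|vset G| - #|cov G Y| = #|vset G :\: cov G Y|.
    by rewrite cardsD (setIidPr sW).
  rewrite mulnC -sum_nat_const; apply: leq_sum => v; rewrite inE => /andP[_]; exact: deg2.
have leV := subset_leq_card sW.
(* The left side is at most [2 * #|eset G|] minus 2 for each vertex outside [cov G Y]; by [le] this
   is at most [2 * #|Y|], the right side. *)
have sum_eq : \sum_(v in cov G Y) degree G v <= \sum_(v in cov G Y) degree GY v.
  by lia.
have deg_eq v : v \in cov G Y -> degree G v <= degree GY v.
  move=> vW; rewrite leqNgt; apply/negP => lt; move: sum_eq.
  rewrite (bigD1 v) //= [X in _ <= X](bigD1 v) //= leqNgt => /negP[].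
  rewrite -addSn leq_add // leq_sum // => w _; exact: degree_edge_inducedS.
(* Equal degrees leave no edge outside [Y] at a covered vertex; connectedness then spreads [Y] over
   all of [G]. *)
have closed e v : e \in eset G -> v \in cov G Y -> v \in ends G e -> e \in Y.
  move=> eG vW ve; apply/negPn/negP => eY; have := deg_eq v vW.
  rewrite leqNgt => /negP[]; rewrite /degree -addSn leq_add //.
    apply: proper_card; apply/properP; split.
      by apply/subsetP => f; rewrite !inE => /andP[/andP[_ ->]].
    by exists e; rewrite !inE ?eG ?ve ?(negbTE eY).
  by apply: subset_leq_card; apply/subsetP => f; rewrite !inE => /andP[/andP[_ ->]].
have WV v : v \in vset G -> v \in cov G Y.
  have e0G := subsetP sY _ e0Y.
  have /and3P[/subsetP s0 /card_gt0P[u ue] _] := endsP e0G.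
  have uW : u \in cov G Y by apply/covP; exists e0.
  move=> vG; have := forall_inP (conn u (s0 _ ue)) v vG.
  case/connectP => p pP ->; elim: p u uW {ue} pP => //= w p IH u uW /andP[uw].
  apply: IH; case/existsP: uw => e /andP[eG /eqP ee].
  apply/covP; exists e; last by rewrite ee set22.
  by apply: (closed e u) => //; rewrite ee set21.
case/negP: nYs; apply/subsetP => e eG.
have /and3P[/subsetP s /card_gt0P[u ue] _] := endsP eG.
by apply: (closed e u) => //; apply/WV/s.
Qed.

(** Dropping one edge destroys the excess, so it is exactly 1. A leaf or a cycle component could be
    removed without lowering the excess, against minimality. *)
Lemma minimal_excess_circuit G C : C \subset eset G ->
  #|cov G C| < #|C| ->
  (forall D, D \proper C -> #|D| <= #|cov G D|) ->
  C \in bicircular_circuits G.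
Proof.
move=> sC exC minC; pose K := edge_induced G C.
have eK : eset K = C by apply/setIidPl.
have vK : vset K = cov G C by rewrite /= (setIidPl sC).
rewrite inE sC /= /Delta eK vK.
have [e0 e0C] : exists e, e \in C by apply/card_gt0P; lia.
have cD : #|C| = #|cov G C|.+1.
  have := minC _ (properD1 e0C); rewrite [#|C|](cardsD1 e0) e0C /=.
  rewrite [#|C|](cardsD1 e0) e0C /= in exC.
  have := subset_leq_card (covS G (subD1set C e0)).
  by lia.
apply/andP; split; first by apply/eqP; lia.
(* Removing [D] would uncover all of [W], at least [#|D|] vertices, and leave a smaller set with
   excess. *)
have small D : D \subset C -> D != set0 -> forall W : {set V}, W \subset cov G C ->
    #|D| <= #|W| -> [disjoint cov G (C :\: D) & W] -> False.
  move=> sD D0 W sW leDW dis.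
  have prop : C :\: D \proper C.
    apply/properP; split; first exact: subsetDl.
    by case/set0Pn: D0 => f fD; exists f; [apply: (subsetP sD) | rewrite inE fD].
  have := minC _ prop; rewrite cardsD (setIidPr sD).
  have : #|cov G (C :\: D)| + #|W| <= #|cov G C|.
    move: dis; rewrite -leq_card_setU => /eqP <-; apply: subset_leq_card.
    by rewrite subUset sW covS // subsetDl.
  have := subset_leq_card sD; move: D0; rewrite -card_gt0; lia.
apply/and3P; split.
- apply/forall_inP => v; rewrite vK => /covP[e eC ve].
  rewrite /degree addn_eq0 negb_and -lt0n; apply/orP; left; apply/card_gt0P.
  by exists e; rewrite inE eK eC.
- apply/forall_inP => v; rewrite vK => vC; apply/negP => /eqP deg1.
  have /covP[e eC ve] := vC.
  have estar : e \in star K v by rewrite inE eK eC.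
  have star1 : #|star K v| <= 1 by rewrite -deg1 leq_addr.
  apply: (small [set e] _ _ [set v]); rewrite ?sub1set ?cards1 //.
    by apply/set0Pn; exists e; rewrite set11.
  rewrite disjoint_sym disjoints1; apply/covP => -[f]; rewrite !inE => /andP[fe fC] vf.
  have fstar : f \in star K v by rewrite inE eK fC.
  by move: fe; rewrite (card_le1_eqP star1 f e fstar estar) eqxx.
- apply/forall_inP => v vin; apply/negP => /andP[_ /forall_inP deg2].
  pose Z := component K v.
  have sZ : eset Z \subset C by apply/subsetP => e; rewrite inE eK => /andP[].
  have sumZ := sum_degree Z.
  rewrite (eq_bigr (fun=> 2)) in sumZ; last by move=> w /deg2/eqP.
  rewrite sum_nat_const in sumZ.
  have vZ : v \in vset Z by rewrite inE vin connect0.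
  have Zpos : 0 < #|vset Z| by apply/card_gt0P; exists v.
  (* With all degrees 2, the degree sum gives the component as many edges as vertices. *)
  apply: (small (eset Z) sZ _ (vset Z)).
  + by rewrite -card_gt0; lia.
  + by rewrite -vK; apply/subsetP => w; rewrite inE => /andP[].
  + by lia.
  rewrite disjoint_sym disjoint_subset; apply/subsetP => w wZ.
  rewrite inE; apply/negP => /covP[e /setDP[eC /negP eZ] we]; apply: eZ.
  rewrite inE eK eC /=; apply/subsetP => u ue.
  have eKe : e \in eset K by rewrite eK.
  have /andP[/subsetP sub _] := endsP eKe.
  rewrite inE sub //=; move: wZ; rewrite inE => /andP[_ vw].
  apply: connect_trans vw _; have [->|wu] := eqVneq w u; first exact: connect0.
  exact/connect1/(adjacent_ends eKe).
Qed.

(** * Independence and nullity *)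

(** For [X] inside [eset G] this is independence in [M1 G], in the form of Hall's condition for
    choosing distinct end-vertices of the edges. *)
Definition indep G X := [forall Y : {set E}, (Y \subset X) ==> (#|Y| <= #|cov G Y|)].

Lemma indepP G X :
  reflect (forall Y, Y \subset X -> #|Y| <= #|cov G Y|) (indep G X).
Proof. by apply: (iffP forallP) => H Y; apply/implyP/(H Y). Qed.

(* The Hall-Rado formula for the nullity of [X]; the witness is the largest
   subset of a basis [I] that covers no more vertices than it has edges. *)
Lemma basis_excess G X : exists I Y,
  [/\ I \subset X, indep G I, Y \subset X & #|X| + #|cov G Y| <= #|Y| + #|I|].
Proof.
pose P := [pred I : {set E} | (I \subset X) && indep G I].
have P0 : P set0.
  rewrite /= sub0set; apply/indepP => Y; rewrite subset0 => /eqP->.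
  by rewrite cards0.
have [I /maxsetP[/andP[sIX iI] maxI] _] := maxset_exists P0.
pose Q := [pred T : {set E} | (T \subset I) && (#|cov G T| <= #|T|)].
have Q0 : Q set0 by rewrite /= sub0set cov0 !cards0.
have [T /maxsetP[/andP[sTI tT] maxT] _] := maxset_exists Q0.
(* The edges of [X :\: I] cover nothing outside [cov G T], so each of them raises the excess by
   one. *)
exists I, (T :|: (X :\: I)); split=> //.
  by rewrite subUset (subset_trans sTI) //= subsetDl.
have covT e : e \in X :\: I -> ends G e \subset cov G T.
  rewrite inE => /andP[eI eX].
  have : ~~ indep G (e |: I).
    apply/negP => iIe; move: eI; rewrite -(maxI (e |: I)) ?setU11 ?subsetUr //=.
    by rewrite subUset sub1set eX sIX.
  rewrite negb_forall => /existsP[Y]; rewrite negb_imply -ltnNge => /andP[sY ltY].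
  have eY : e \in Y.
    apply/negPn/negP => eY; move: ltY; rewrite ltnNge => /negP[].
    apply: (indepP _ _ iI); apply/subsetP => f fY.
    by move: (subsetP sY f fY) eY; rewrite !inE => /orP[/eqP<-|//]; rewrite fY.
  (* [Y :\ e] is independent while [Y] has excess, so [Y :\ e] is tight (as many vertices as edges)
     and already covers the ends of [e]. *)
  have sY' : Y :\ e \subset I by rewrite subDset.
  have iY' := indepP _ _ iI _ sY'.
  have cY' : #|cov G (Y :\ e)| <= #|cov G Y| by rewrite subset_leq_card ?covS ?subD1set.
  rewrite [#|Y|](cardsD1 e) eY /= in ltY.
  have covY : cov G (Y :\ e) = cov G Y.
    by apply/eqP; rewrite eqEcard covS ?subD1set //=; lia.
  (* By submodularity of [#|cov G _|], a union of tight subsets of [I] is tight; maximality of [T]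
     absorbs it. *)
  have <- : T :|: (Y :\ e) = T.
    apply: maxT; last exact: subsetUl.
    rewrite /= subUset sTI sY' /= covU cardsU cardsU covY.
    have : #|T :&: (Y :\ e)| <= #|cov G T :&: cov G Y|.
      apply: leq_trans (indepP _ _ iI _ _) (subset_leq_card _).
        by apply: subset_trans sTI; apply: subsetIl.
      by rewrite subsetI covS ?subsetIl // -covY covS // subsetIr.
    have := subset_leq_card (subsetIl T (Y :\ e)).
    have := subset_leq_card (subsetIl (cov G T) (cov G Y)).
    by lia.
  rewrite covU covY; apply: subset_trans (subsetUr _ _).
  by apply/subsetP => v ve; apply/covP; exists e.
have -> : cov G (T :|: X :\: I) = cov G T.
  by rewrite covU; apply/setUidPl/bigcupsP.
have -> : #|T :|: X :\: I| = #|T| + #|X :\: I|.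
  rewrite cardsU (_ : T :&: (X :\: I) = set0) ?cards0 ?subn0 //.
  by rewrite setIDA; apply/eqP; rewrite setD_eq0; apply: subset_trans sTI; apply: subsetIl.
by rewrite cardsD (setIidPr sIX); have := subset_leq_card sIX; lia.
Qed.

Lemma dependent_circuit G X : X \subset eset G -> ~~ indep G X ->
  exists2 C, C \in bicircular_circuits G & C \subset X.
Proof.
move=> sX; rewrite negb_forall => /existsP[Y]; rewrite negb_imply -ltnNge => /andP[sY exY].
pose P := [pred D : {set E} | #|cov G D| < #|D|].
have [C /minsetP[exC minC] sC] := minset_exists (P := P) exY.
exists C; last exact: subset_trans sY.
apply: minimal_excess_circuit => //.
  exact: subset_trans sC (subset_trans sY sX).
move=> D pD; rewrite leqNgt; apply/negP => exD.
by move: (pD); rewrite (minC D) ?properxx // proper_sub.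
Qed.

Lemma circuit_excess G C : C \in bicircular_circuits G -> #|cov G C| < #|C|.
Proof.
rewrite inE => /and3P[sC /eqP DC _]; move: DC.
by rewrite /Delta /= (setIidPl sC) -/(cov G C); lia.
Qed.

End EndVertices.

(** * Comparing two graphs with the same matroid *)

Section SameMatroid.

Variables (V V' E : finType) (G : mgraph V E) (G' : mgraph V' E).
Hypothesis eqM : M1 G' = M1 G.

Lemma M1_eset : eset G' = eset G.
Proof. by case: eqM. Qed.

Lemma M1_indep (X : {set E}) : X \subset eset G -> indep G X -> indep G' X.
Proof.
move=> sX iX; apply/negPn/negP => dX.
have [|C CG' sC] := dependent_circuit _ dX; first by rewrite M1_eset.
have CG : C \in bicircular_circuits G by case: eqM CG' => _ ->.
by have := circuit_excess CG; rewrite ltnNge (indepP _ _ iX).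
Qed.

(** A basis of [X] in [G] is independent in [G'], hence has at most [#|cov G' X|] edges: the nullity
    computed in [G] bounds the excess of [X] in [G']. *)
Lemma M1_excess (X : {set E}) : X \subset eset G ->
  exists2 Y : {set E}, Y \subset X & #|X| + #|cov G Y| <= #|Y| + #|cov G' X|.
Proof.
move=> sX; have [I [Y [sI iI sY le]]] := basis_excess G X.
exists Y => //.
have iI' := M1_indep (subset_trans sI sX) iI.
have := indepP _ _ iI' _ (subxx I).
have := subset_leq_card (covS G' sI).
by lia.
Qed.

End SameMatroid.

Lemma M1_card_cov (V V' E : finType) (G : mgraph V E) (G' : mgraph V' E)
    (H : {set E}) :
  M1 G' = M1 G -> H \subset eset G ->
  (forall Y : {set E}, Y \proper H -> #|Y| + #|cov G H| < #|H| + #|cov G Y|) ->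
  #|cov G' H| = #|cov G H|.
Proof.
move=> eqM sH strict; have eqM' := esym eqM.
have weak (Y : {set E}) : Y \subset H -> #|Y| + #|cov G H| <= #|H| + #|cov G Y|.
  by rewrite subEproper => /orP[/eqP->//|/strict/ltnW].
have [Y sY leY] := M1_excess eqM sH.
have := weak Y sY.
have [|Z sZ leZ] := M1_excess eqM' (X := H); first by rewrite (M1_eset eqM).
have [ZH|nZH] := eqVneq Z H; first by rewrite ZH in leZ; lia.
have pZ : Z \proper H by rewrite properEneq nZH.
(* Transferring back to [G] yields a [T] properly inside [H] with at least the excess of [H]. *)
have [T sT leT] := M1_excess eqM (subset_trans sZ sH).
by have := strict T (sub_proper_trans sT pZ); lia.
Qed.

(** * Recovering the stars and the isomorphism *)

Section Stars.

Variables (V V' E : finType) (G : mgraph V E) (G' : mgraph V' E).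

Lemma star_of_M1 x : no_isolated G' -> (1 <= Delta G)%R -> connected_bowtie G ->
  x \in vset G -> (1 <= Delta (del_vertex G x))%R ->
  connected_bowtie (del_vertex G x) -> M1 G' = M1 G ->
  exists2 y, y \in vset G' & star G' y = star G x.
Proof.
move=> iso' D1 cb xG Dx cbx eqM.
have eE := M1_eset eqM.
have iso : no_isolated G by case/andP: cb => _ /and3P[].
have isox : no_isolated (del_vertex G x) by case/andP: cbx => _ /and3P[].
pose H := eset (del_vertex G x).
have sH : H \subset eset G by apply/subsetP => e; rewrite inE => /andP[].
(* [del_vertex] keeps the map [ends], so covers in the deleted graph are covers in [G]. *)
have covH : cov G H = vset G :\ x := cov_eset isox.
have cardV' : #|vset G'| = #|vset G|.
  rewrite -!cov_eset // eE; apply: M1_card_cov => // Y; exact: excess_proper.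
have strict (Y : {set E}) : Y \proper H -> #|Y| + #|cov G H| < #|H| + #|cov G Y|.
  exact: (@excess_proper _ _ (del_vertex G x)).
have cardH : #|cov G' H| = #|cov G H| by apply: M1_card_cov.
have sH' : cov G' H \subset vset G' by apply: cov_sub_vset; rewrite eE.
have /cards1P[y Ey] : #|vset G' :\: cov G' H| == 1.
  rewrite cardsD (setIidPr sH') cardH covH cardV' (cardsD1 x (vset G)) xG.
  by apply/eqP; lia.
have : y \in vset G' :\: cov G' H by rewrite Ey set11.
rewrite inE => /andP[yH yG']; exists y => //.
have notH e : e \in eset G -> (e \notin H) = (x \in ends G e).
  by move=> eG; rewrite inE eG negbK.
apply/setP => e; rewrite !inE eE; case eG : (e \in eset G) => //=.
rewrite -notH //; apply/idP/idP => [ye|eH].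
  by apply/negP => eH; case/negP: yH; apply/covP; exists e.
apply/negPn/negP => ye.
have ecov : cov G' (e |: H) = cov G' H.
  rewrite covU; apply/setUidPr; rewrite /cov big_set1; apply/subsetP => v ve.
  have eG' : e \in eset G' by rewrite eE.
  have vG' : v \in vset G' by case/andP: (endsP eG') => /subsetP ->.
  apply/negPn/negP => vH.
  have : v \in vset G' :\: cov G' H by rewrite inE vH.
  by rewrite Ey inE => /eqP vy; rewrite -vy ve in ye.
(* In [G'] the edge [e] would add excess to [H] without a new vertex. In [G] no [Y] inside [e |: H]
   beats the excess of [H], since [e] brings the new vertex [x]. *)
have [|Y sY] := M1_excess eqM (X := e |: H); first by rewrite subUset sub1set eG.
rewrite ecov cardH cardsU1 eH leqNgt => /negP; apply.
have sYe : Y :\ e \subset H by rewrite subDset.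
have weak : #|Y :\ e| + #|cov G H| <= #|H| + #|cov G (Y :\ e)|.
  by move: sYe; rewrite subEproper => /orP[/eqP->//|/strict/ltnW].
have sub := subD1set Y e.
rewrite (cardsD1 e Y); have [eY|eY] := boolP (e \in Y); last first.
  by rewrite !add0n ltnS (leq_trans weak) // leq_add // subset_leq_card ?covS.
rewrite -!addnA ltn_add2l (leq_ltn_trans weak) // ltn_add2l.
apply/proper_card/properP; split; first by rewrite covS.
exists x; first by apply/covP; exists e; rewrite // -notH.
by apply/negP => /(subsetP (covS G sYe)); rewrite covH !inE eqxx.
Qed.

(** If two vertices had the same star, deleting one would isolate the other. *)
Lemma star_inj : (forall x, x \in vset G -> no_isolated (del_vertex G x)) ->
  {in vset G &, injective (star G)}.
Proof.
move=> iso x y xG yG Exy; apply/eqP/negPn/negP => nxy.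
have : y \in vset (del_vertex G x) by rewrite !inE eq_sym nxy.
rewrite -(cov_eset (iso x xG)) => /covP[e]; rewrite inE => /andP[eG /negP xe] ye; apply: xe.
have : e \in star G y by rewrite inE eG.
by rewrite -Exy inE => /andP[].
Qed.

(** Stars record all vertex-edge incidences, so matching vertices with equal stars carries [ends G]
    to [ends G']. *)
Lemma strongly_isomorphic_of_stars :
  eset G = eset G' -> {in vset G &, injective (star G)} ->
  {in vset G' &, injective (star G')} -> stars G = stars G' ->
  strongly_isomorphic G G'.
Proof.
move=> eE inj inj' Est; split=> //.
have ex (x : {x : V | x \in vset G}) :
    exists y, (y \in vset G') && (star G' y == star G (val x)).
  have : star G (val x) \in stars G' by rewrite -Est imset_f // (valP x).
  by case/imsetP => y yG ->; exists y; rewrite yG eqxx.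
have ex' (y : {y : V' | y \in vset G'}) :
    exists x, (x \in vset G) && (star G x == star G' (val y)).
  have : star G' (val y) \in stars G by rewrite Est imset_f // (valP y).
  by case/imsetP => x xG ->; exists x; rewrite xG eqxx.
pose nu x : {y : V' | y \in vset G'} :=
  exist _ (xchoose (ex x)) (proj1 (andP (xchooseP (ex x)))).
pose mu y : {x : V | x \in vset G} :=
  exist _ (xchoose (ex' y)) (proj1 (andP (xchooseP (ex' y)))).
have nuE x : star G' (val (nu x)) = star G (val x).
  by apply/eqP; case/andP: (xchooseP (ex x)).
have muE y : star G (val (mu y)) = star G' (val y).
  by apply/eqP; case/andP: (xchooseP (ex' y)).
have nuK : cancel nu mu.
  by move=> x; apply/val_inj/inj; rewrite ?(valP (mu _)) ?(valP x) // muE nuE.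
have muK : cancel mu nu.
  by move=> y; apply/val_inj/inj'; rewrite ?(valP (nu _)) ?(valP y) // nuE muE.
exists nu; split; first by exists mu.
move=> e eG x y.
have eG' : e \in eset G' by rewrite -eE.
have nu_ends z : (val (nu z) \in ends G' e) = (val z \in ends G e).
  by move/setP/(_ e): (nuE z); rewrite !inE eG eG'.
have [/subsetP s _] := andP (endsP eG); have [/subsetP s' _] := andP (endsP eG').
split=> Ee; apply/setP => z.
- apply/idP/idP => [ze|]; last first.
    by rewrite !inE => /orP[]/eqP->; rewrite nu_ends Ee !inE eqxx ?orbT.
  pose z' : {y : V' | y \in vset G'} := exist _ z (s' z ze).
  have : val (mu z') \in ends G e by rewrite -nu_ends muK.
  by rewrite Ee !inE !(inj_eq val_inj) !(can2_eq muK nuK) -!(inj_eq val_inj).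
- apply/idP/idP => [ze|]; last first.
    by rewrite !inE => /orP[]/eqP->; rewrite -nu_ends Ee !inE eqxx ?orbT.
  pose z' : {x : V | x \in vset G} := exist _ z (s z ze).
  have : val (nu z') \in ends G' e by rewrite nu_ends.
  by rewrite Ee !inE !(inj_eq val_inj) !(can_eq nuK) -!(inj_eq val_inj).
Qed.

End Stars.

Theorem theorem5p7 (V V' E : finType) (G : mgraph V E) (G' : mgraph V' E)
    (hG' : no_isolated G')
    (a1 : (1 <= Delta G)%R /\ connected_bowtie G)
    (a2 : forall x : V, x \in vset G ->
      (1 <= Delta (del_vertex G x))%R /\ connected_bowtie (del_vertex G x))
    (a3 : M1 G' = M1 G) :
  stars G = stars G' /\ strongly_isomorphic G G'.
Proof.
have [D1 cb] := a1.
have inj : {in vset G &, injective (star G)}.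
  by apply: star_inj => x /a2[_ /andP[_ /and3P[]]].
have iso : no_isolated G by case/andP: cb => _ /and3P[].
have cardV' : #|vset G'| = #|vset G|.
  rewrite -!cov_eset // (M1_eset a3).
  by apply: M1_card_cov => // Y; exact: excess_proper.
have card_stars : #|stars G| = #|vset G| by apply: card_in_imset.
have sub : stars G \subset stars G'.
  apply/subsetP => _ /imsetP[x xG ->]; have [Dx cbx] := a2 x xG.
  have [y yG' <-] := star_of_M1 hG' D1 cb xG Dx cbx a3.
  exact: imset_f.
have le' : #|stars G'| <= #|vset G'| by apply: leq_imset_card.
have Est : stars G = stars G'.
  by apply/eqP; rewrite eqEcard sub card_stars -cardV'.
split=> //; apply: strongly_isomorphic_of_stars => //.
  by rewrite (M1_eset a3).
(* [G'] has as many stars as vertices, which forces [star G'] to be injective. *)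
by apply/imset_injP; rewrite -/(stars G') -Est card_stars cardV'.
Qed.
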